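(* Let $f_1,\dots,f_m$ be analytic functions of $m$ real variables and let $\vec x^*=(x_1^*,\dots,x_m^* )$ be an equilibrium of the target system $dx_i/dt=f_i(\vec x)$, $i=1,\dots,m$. Let $S$ be an ordering and consider the system for $\vec X_1,\dots,\vec X_m\in\mathbb{R}^N$ $$\frac{d\vec X_i}{dt}=\boldsymbol{\Omega}_1\boldsymbol{F}^{(nc)}_i(\vec X_1,\dots,\vec X_m)\vec 1+\boldsymbol{Q}_i(\boldsymbol{\Omega}_1)\vec X_i,\qquad i=1,\dots,m,$$ built on the standard non-commutative map $\boldsymbol{F}^{(nc)}_i$ with ordering $S$, where the linear decay functions $\boldsymbol{Q}_i(\boldsymbol{\Omega}_1)\vec X_i$ ($\boldsymbol{Q}_i(\boldsymbol{\Omega}_1)$ an $N\times N$ matrix) are $\boldsymbol{\Omega}_1$-eligible. Then, for any ordering $S$, the Jacobian matrix of the right-hand side evaluated at the equilibrium $\vec X_i^*=x_i^*\vec 1$, $i=1,\dots,m$, has $N\times N$ blocks ($i,j=1,\dots,m$; block $(i,j)$ is the derivative of the $i$-th vector equation with respect to $\vec X_j$) $$\boldsymbol{J}^{(nc)}_{ij}(\{\vec X_i^*\})=\frac{\partial f_i}{\partial x_j}(\vec x^* )\,\boldsymbol{\Omega}_1+\delta_{ij}\boldsymbol{Q}_i(\boldsymbol{\Omega}_1).$$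
   Context: $\vec 1\in\mathbb{R}^N$ is the all-ones vector, $\boldsymbol{I}$ the $N\times N$ identity, $\boldsymbol{\Omega}_1$ the $N\times N$ matrix with all entries $1/N$; for $\vec X_i=(X_{i,1},\dots,X_{i,N})$, $\boldsymbol{X}_i=\mathrm{diag}(X_{i,1},\dots,X_{i,N})$. Each $f_i$ is represented by its Taylor series $f_i(x_1,\dots,x_m)=\sum_{k\ge0}\sum_{j_1+\dots+j_m=k}a_{i,k;j_1,\dots,j_m}x_1^{j_1}\cdots x_m^{j_m}$ on all of $\mathbb{R}^m$. A matrix to the power zero is the identity. An ordering $S$ is a choice of real coefficients $o_\sigma$, $\sigma$ ranging over the permutations $\mathcal{S}(m)$ of $\{1,\dots,m\}$, with $\sum_\sigma o_\sigma=1$; then $\{(\boldsymbol{\Omega}_1\boldsymbol{X}_1)^{j_1}\cdots(\boldsymbol{\Omega}_1\boldsymbol{X}_m)^{j_m}\}_S=\sum_{\sigma}o_\sigma(\boldsymbol{\Omega}_1\boldsymbol{X}_{\sigma(1)})^{j_{\sigma(1)}}\cdots(\boldsymbol{\Omega}_1\boldsymbol{X}_{\sigma(m)})^{j_{\sigma(m)}}$. Standard non-commutative map: $\boldsymbol{F}^{(nc)}_i=\sum_{k\ge0}\sum_{j_1+\dots+j_m=k}a_{i,k;j_1,\dots,j_m}\{(\boldsymbol{\Omega}_1\boldsymbol{X}_1)^{j_1}\cdots(\boldsymbol{\Omega}_1\boldsymbol{X}_m)^{j_m}\}_S$. A decay function $\vec G_i(\boldsymbol{\Omega}_1;\vec X_i)$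 is $\boldsymbol{\Omega}_1$-eligible if, along solutions of the extended system, $\lim_{t\to+\infty}\boldsymbol{\Omega}_1\vec G_i(\boldsymbol{\Omega}_1;\vec X_i(t))=\vec 0$ and if $\vec X_{ci}=(\boldsymbol{I}-\boldsymbol{\Omega}_1)\vec X_i$, which satisfies $\frac{d\vec X_{ci}}{dt}=(\boldsymbol{I}-\boldsymbol{\Omega}_1)\vec G_i(\boldsymbol{\Omega}_1;\vec X_i)$, tends to $\vec 0$ as $t\to\infty$. *)

(* Defs.v *)
From HB Require Import structures.
From mathcomp Require Import all_boot all_order all_algebra all_fingroup.
From mathcomp Require Import all_classical all_reals all_analysis.

Set Implicit Arguments.
Unset Strict Implicit.
Unset Printing Implicit Defensive.

Import Order.TTheory GRing.Theory Num.Theory numFieldNormedType.Exports.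
Local Open Scope classical_set_scope.
Local Open Scope ring_scope.

(* A state (X_1, ..., X_m) of vectors in R^N is a matrix
   X : 'M_(N, m) whose i-th column col i X is X_i.  Coefficients of a power
   series in m variables are a function of the multi-index (j_1, ..., j_m); the
   total degree k is their sum, so it is not a separate index of a. *)

Section ExtendedSystem.
Variables (R : realType) (m N : nat).

Definition represented_by (f : 'rV[R]_m -> R) (a : ('I_m -> nat) -> R) : Prop :=
  forall x : 'rV[R]_m,
    series (fun k : nat =>
      \sum_(j : {ffun 'I_m -> 'I_k.+1} | (\sum_l j l)%N == k)
        a (fun l => j l : nat) * \prod_(l < m) x 0 l ^+ j l) @ \oo --> f x.

Definition Omega1 : 'M[R]_N := const_mx (N%:R^-1).

Definition OmegaX (X : 'M[R]_(N, m)) (l : 'I_m) : 'M[R]_N :=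
  Omega1 *m diag_mx (col l X)^T.

Definition is_ordering (o : 'S_m -> R) : Prop := \sum_(s : 'S_m) o s = 1.

(* The products are non-commutative and taken from left to right. *)
Definition ordered_monomial (o : 'S_m -> R) (X : 'M[R]_(N, m))
    (j : 'I_m -> nat) : 'M[R]_N :=
  \sum_(s : 'S_m) o s *: \prod_(l < m) OmegaX X (s l) ^+ j (s l).

Definition nc_map (a : ('I_m -> nat) -> R) (o : 'S_m -> R)
    (X : 'M[R]_(N, m)) : 'M[R]_N :=
  lim (series (fun k : nat =>
    \sum_(j : {ffun 'I_m -> 'I_k.+1} | (\sum_l j l)%N == k)
      a (fun l => j l : nat) *:
        ordered_monomial o X (fun l => j l : nat)) @ \oo).

Definition extended_rhs (a : 'I_m -> ('I_m -> nat) -> R) (o : 'S_m -> R)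
    (G : 'I_m -> 'cV[R]_N -> 'cV[R]_N) (X : 'M[R]_(N, m)) : 'M[R]_(N, m) :=
  \matrix_(p, i)
    (Omega1 *m nc_map (a i) o X *m const_mx 1 + G i (col i X)) p 0.

Definition is_solution (V : 'M[R]_(N, m) -> 'M[R]_(N, m))
    (X : R -> 'M[R]_(N, m)) : Prop :=
  {within `[0, +oo[, continuous X} /\
  forall t : R, 0 < t -> is_derive t 1 X (V (X t)).

(* Eligibility of G i is relative to the whole system, i.e. to all the G's. *)
Definition eligible (a : 'I_m -> ('I_m -> nat) -> R) (o : 'S_m -> R)
    (G : 'I_m -> 'cV[R]_N -> 'cV[R]_N) (i : 'I_m) : Prop :=
  forall X : R -> 'M[R]_(N, m), is_solution (extended_rhs a o G) X ->
    (Omega1 *m G i (col i (X t)) @[t --> +oo] --> (0 : 'cV[R]_N)) /\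
    ((1%:M - Omega1) *m col i (X t) @[t --> +oo] --> (0 : 'cV[R]_N)).

(* Entry (p, q) is the partial derivative of component p of the i-th vector
   equation with respect to X_{j,q}, which is the entry (q, j) of the state. *)
Definition jacobian_block (V : 'M[R]_(N, m) -> 'M[R]_(N, m))
    (X : 'M[R]_(N, m)) (i j : 'I_m) : 'M[R]_N :=
  \matrix_(p, q) 'D_(delta_mx q j) (fun Y => V Y p i) X.

Definition uniform_state (x : 'rV[R]_m) : 'M[R]_(N, m) :=
  \matrix_(p, i) x 0 i.

End ExtendedSystem.

(* Main.v *)
(** Since Omega_1 X_l maps the all-ones vector to mean(X_l) times itself, every
    ordered monomial applied to it gives the ordinary monomial in the means, so
    the vector field is f_i(mean X_1, ..., mean X_m) 1 + Q_i X_i wherever the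
    matrix series converges, and the Jacobian follows by the chain rule.

    Both that convergence and the differentiability of f_i must be extracted
    from the mere pointwise convergence on R^m of the homogeneous expansion
    sum_k P_k.  Pointwise, P_k decays faster than every geometric sequence; the
    point is to transfer this to the coefficients, one variable at a time.  In
    one variable, the closed sets where sup_k |p_k(s)| T^k <= n increase to
    [0, 1], so one of them has measure more than 1/2.  It contains, for every d,
    d + 1 points with gaps of order 1/d, and Lagrange interpolation at them
    bounds the coefficients of a polynomial of degree d up to a factor C^d with
    C independent of T. *)
Require Import Defs.
From HB Require Import structures.
From mathcomp Require Import all_boot all_order all_algebra all_fingroup.
From mathcomp Require Import all_classical all_reals all_analysis.
From mathcomp Require Import ring lra zify.
Set Implicit Arguments.
Unset Strict Implicit.

Import Order.TTheory GRing.Theory Num.Theory numFieldNormedType.Exports.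
Local Open Scope classical_set_scope.
Local Open Scope ring_scope.

(** * Interpolation at spaced nodes *)

Lemma bin_le_expn2 (n k : nat) : ('C(n, k) <= 2 ^ n)%N.
Proof.
have := card_draws 'I_n k; rewrite card_ord => <-.
apply: leq_trans (max_card _) _.
by rewrite -cardsT -powersetT card_powerset cardsT card_ord.
Qed.

(** Compare both sides with the product of the integers from [d + 1] to [2 d]: its [d] factors are
    at least [d + 1], and it is the factorial of [d] times a binomial coefficient that is at most
    [4 ^ d]. *)
Lemma pow_le_expn_fact (d : nat) : (d.+1 ^ d <= 4 ^ d * d`!)%N.
Proof.
have le4 : ('C(d + d, d) <= 4 ^ d)%N.
  by rewrite (leq_trans (bin_le_expn2 _ _)) // addnn -mul2n expnM.
apply: (leq_trans _ (leq_mul le4 (leqnn _))).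
rewrite bin_ffact ffact_prod -[X in (_ ^ X)%N]card_ord -prod_nat_const.
by apply: leq_prod => i _; have := ltn_ord i; lia.
Qed.

Definition l1_norm (R : numDomainType) (p : {poly R}) : R := \sum_(i < size p) `|p`_i|.

Lemma l1_normE (R : numDomainType) (p : {poly R}) n : (size p <= n)%N ->
  l1_norm p = \sum_(i < n) `|p`_i|.
Proof.
move=> le_pn; rewrite /l1_norm (big_ord_widen n (fun i => `|p`_i|)) //.
rewrite big_mkcond /=; apply: eq_bigr => i _.
by case: ltnP => // hi; rewrite nth_default ?normr0.
Qed.

Lemma coef_le_l1 (R : numDomainType) (p : {poly R}) (i : nat) : `|p`_i| <= l1_norm p.
Proof.
rewrite (@l1_normE _ _ (maxn (size p) i.+1)) ?leq_maxl //.
have hi : (i < maxn (size p) i.+1)%N by rewrite leq_max ltnSn orbT.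
by rewrite (bigD1 (Ordinal hi)) //= lerDl; apply: sumr_ge0.
Qed.

Lemma l1_norm_mulXsubC (R : numDomainType) (p : {poly R}) (c : R) : `|c| <= 1 ->
  l1_norm (p * ('X - c%:P)) <= 2 * l1_norm p.
Proof.
move=> c1.
have sz : (size (p * ('X - c%:P))%R <= (size p).+1)%N.
  by have := size_polyMleq p ('X - c%:P); rewrite size_XsubC addn2.
rewrite (@l1_normE _ _ _ sz).
apply: (@le_trans _ _ (\sum_(i < (size p).+1) (`|(p * 'X)`_i| + `|p`_i|))).
  apply: ler_sum => i _; rewrite mulrBr coefB (le_trans (ler_normB _ _))// lerD2l.
  by rewrite coefMC normrM ler_piMr.
rewrite big_split /= mulrDl mul1r -(@l1_normE _ _ _ (leqnSn _)) lerD2r.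
by rewrite big_ord_recl /= coefMX eqxx normr0 add0r; apply: ler_sum => i _; rewrite coefMX.
Qed.

Lemma l1_norm_prod_XsubC (R : numDomainType) (I : Type) (r : seq I) (P : pred I) (c : I -> R) :
  (forall i, P i -> `|c i| <= 1) ->
  l1_norm (\prod_(i <- r | P i) ('X - (c i)%:P)) <= 2 ^+ size r.
Proof.
move=> c1; elim: r => [|i r IH].
  by rewrite big_nil /l1_norm size_poly1 big_ord1 coef1 normr1 expr0.
rewrite big_cons /= exprS; case: ifP => Pi; last first.
  by apply: (le_trans IH); rewrite ler_peMl ?exprn_ge0 // ler1n.
rewrite mulrC (le_trans (l1_norm_mulXsubC _ (c1 _ Pi))) //.
by rewrite ler_wpM2l.
Qed.

Lemma prod_gap_ge (R : realDomainType) (d : nat) (s : nat -> R) (h : R) (k : 'I_d.+1) : 0 <= h ->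
  (forall i j, (i <= j)%N -> (j - i)%:R * h <= s j - s i) ->
  h ^+ d * (k`! * (d - k)`!)%:R <= `|\prod_(j < d.+1 | j != k) (s k - s j)|.
Proof.
move=> h0 hs; rewrite normr_prod.
(* With truncated subtraction, [i - j + (j - i)] is the distance between [i] and [j]. *)
have hl (i j : nat) : (i - j + (j - i))%:R * h <= `|s i - s j|.
  case: (leqP i j) => ij.
    by rewrite (eqP ij) distrC (le_trans (hs _ _ ij)) ?ler_norm.
  by rewrite (eqP (ltnW ij)) addn0 (le_trans (hs _ _ (ltnW ij))) ?ler_norm.
apply: (@le_trans _ _ (\prod_(j < d.+1 | j != k) ((k - j + (j - k))%N%:R * h))); last first.
  by apply: ler_prod => j _; rewrite hl mulr_ge0.
rewrite big_split /= mulrC prodr_const cardC1 card_ord /= -natr_prod.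
rewrite ler_wpM2r ?exprn_ge0 // ler_nat.
suff -> : (\prod_(j < d.+1 | j != k) (k - j + (j - k))%N = k`! * (d - k)`!)%N by [].
have -> : (\prod_(j < d.+1 | j != k) (k - j + (j - k))%N =
  \prod_(0 <= j < d.+1) (if j == k :> nat then 1 else (k - j + (j - k))%N))%N.
  by rewrite big_mkord big_mkcond /=; apply: eq_bigr => j _; rewrite -val_eqE /=; case: eqP.
have kd : (k <= d)%N by rewrite -ltnS.
(* The distances from [k] to the smaller indices multiply to the factorial of [k], those to the
   larger ones to the factorial of [d - k]. *)
rewrite (big_cat_nat (n := k)) //= 1?ltnW // (big_nat_recl _ _ _ kd) eqxx mul1n; congr (_ * _)%N.
  rewrite big_nat_rev /= fact_prod big_add1 /=.
  rewrite big_nat [RHS]big_nat; apply: eq_bigr => j /andP[_ jk].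
  by rewrite ifN; lia.
rewrite fact_prod big_add1 /= -{1}[nat_of_ord k]add0n big_addn.
rewrite big_nat [RHS]big_nat; apply: eq_bigr => j /andP[_ jk].
by rewrite ifN; lia.
Qed.

(** In Lagrange's formula the numerator of a basis polynomial has coefficients at most [2 ^ d.+1],
    and [prod_gap_ge] bounds its denominator from below. By [pow_le_expn_fact] and the bound [2 ^ d]
    on binomial coefficients, the quotient is at most [2 * 64 ^ d]. *)
Lemma coef_bound_of_spaced_nodes (R : realFieldType) (d : nat) (p : {poly R})
    (s : nat -> R) (M : R) :
  (size p <= d.+1)%N ->
  (forall i j, (i <= j)%N -> (j - i)%:R * (4 * d.+1)%:R^-1 <= s j - s i) ->
  (forall i, (i <= d)%N -> 0 <= s i <= 1 /\ `|p.[s i]| <= M) ->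
  forall i, `|p`_i| <= M * (2 * 128 ^+ d).
Proof.
move=> szp hs hp n; set h := (4 * d.+1)%:R^-1 in hs.
have h0 : 0 < h by rewrite invr_gt0 ltr0n.
have M0 : 0 <= M by have [_ /(le_trans _)] := hp 0%N isT; apply.
have s_inj : injective s.
  have lt i j : (i < j)%N -> s i < s j.
    move=> ij; rewrite -subr_gt0 (lt_le_trans _ (hs _ _ (ltnW ij))) //.
    by rewrite mulr_gt0 // ltr0n subn_gt0.
  move=> i j sij; apply/eqP; rewrite eqn_leq; apply/andP; split; rewrite leqNgt; apply/negP => /lt;
  by rewrite sij ltxx.
rewrite (lagrange_gen (ltn0Sn d) s_inj szp) coef_sum.
apply: (le_trans (ler_norm_sum _ _ _)).
(* Summing over the [d + 1 <= 2 ^ d] nodes raises 64 to 128. *)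
apply: (@le_trans _ _ (\sum_(i < d.+1) M * (2 * 64 ^+ d))); last first.
  rewrite sumr_const card_ord -mulrnAr ler_wpM2l // -mulrnAr ler_wpM2l //.
  rewrite (_ : 128 = 2 * 64 :> R); last by rewrite -natrM.
  rewrite exprMn -mulr_natl ler_wpM2r ?exprn_ge0 // -natrX ler_nat.
  by rewrite ltn_expl.
apply: ler_sum => k _; rewrite lagrangeE // coefCM coefCM !normrM normfV.
have [_ hpk] := hp k (ltn_ord k).
apply: ler_pM; rewrite ?mulr_ge0 ?invr_ge0 //.
rewrite mulrC.
have hcoef : `|(\prod_(j < d.+1 | j != k :> nat) ('X - (s j)%:P))`_n| <= 2 ^+ d.+1.
  apply: (le_trans (coef_le_l1 _ _)).
  apply: (le_trans (l1_norm_prod_XsubC _ _)); last by rewrite /index_enum -enumT size_enum_ord.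
  by move=> j _; have [/andP[? ?] _] := hp j (ltn_ord j); rewrite ger0_norm.
have hgap := prod_gap_ge k (ltW h0) hs.
rewrite horner_prod; under [X in _ / `|X|]eq_bigr do rewrite hornerXsubC.
have kd : (k <= d)%N by rewrite -ltnS.
have pos : 0 < h ^+ d * (k`! * (d - k)`!)%:R.
  by rewrite mulr_gt0 ?exprn_gt0 // ltr0n muln_gt0 !fact_gt0.
rewrite ler_pdivrMr; last exact: lt_le_trans hgap.
apply: (le_trans hcoef); apply: (le_trans _ (ler_wpM2l _ hgap));
  last by rewrite mulr_ge0 ?exprn_ge0.
rewrite /h exprVn mulrCA mulrC -ler_pdivrMr ?invr_gt0 ?exprn_gt0 ?ltr0n // invrK.
rewrite -!natrX -!natrM ler_nat expnMn (expnS 2) -!mulnA leq_mul2l /=.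
apply: leq_trans (_ : 2 ^ d * (4 ^ d * (4 ^ d * (2 ^ d * (k`! * (d - k)`!))))  <= _)%N; last first.
  by rewrite !mulnA -!expnMn.
rewrite !leq_mul2l; apply/orP; right; apply/orP; right.
apply: (leq_trans (pow_le_expn_fact d)); rewrite leq_mul2l; apply/orP; right.
rewrite -(bin_fact kd) leq_mul2r; apply/orP; right.
exact: bin_le_expn2.
Qed.

(** * Decay of coefficients in one variable *)

Lemma sorted_ltn_nth_gap (t : seq nat) (i j : nat) : sorted ltn t -> (i <= j)%N -> (j < size t)%N ->
  (nth 0 t i + (j - i) <= nth 0 t j)%N.
Proof.
move=> st; elim: j => [|j IH] ij jt; first by move: ij; rewrite leqn0 => /eqP->; rewrite addn0.
move: ij; rewrite leq_eqVlt => /predU1P[->|ij]; first by rewrite subnn addn0.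
have := IH ij (ltnW jt); have /(sortedP 0%N)/(_ _ jt) := st; lia.
Qed.

(* [E] meets more than half of the [4 (d + 1)] intervals of a regular subdivision;
   a point in every other one of these yields the gaps. *)
Lemma spaced_points (R : realType) (E : set R) (d : nat) :
  measurable E -> E `<=` `[0, 1]%classic -> ((2^-1)%:E < lebesgue_measure E)%E ->
  exists s : nat -> R,
    (forall i j, (i <= j)%N -> (j - i)%:R * (4 * d.+1)%:R^-1 <= s j - s i) /\
    (forall i, (i <= d)%N -> E (s i)).
Proof.
move=> mE E01 muE; have [L LE] : exists L, L = (4 * d.+1)%N by exists (4 * d.+1)%N.
have L0 : (0 < L)%N by rewrite LE.
rewrite -LE; set h : R := L%:R^-1.
have h0 : 0 < h by rewrite invr_gt0 ltr0n.
have Lh : L%:R * h = 1 by rewrite mulfV // pnatr_eq0 -lt0n.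
pose I n : set R := `[n%:R * h, n.+1%:R * h]%classic.
pose t := [seq n <- iota 0 L | `[< (E `&` I n) !=set0 >]].
have covE : E `<=` \big[setU/set0]_(n <- t) I n.
  move=> x Ex; have /= := E01 x Ex; rewrite in_itv /= => /andP[x0 x1].
  have [n nL xI] : exists2 n, (n < L)%N & I n x.
    (* At [x = 1] truncating [x * L] would give the index [L], out of range, so this point goes to
       the last interval. *)
    have [->|xn1] := eqVneq x 1.
      exists L.-1; first by rewrite prednK.
      rewrite /I /= in_itv /= prednK // Lh lexx andbT -[leRHS]Lh.
      by rewrite ler_wpM2r ?(ltW h0) // ler_nat leq_pred.
    have xL0 : 0 <= x * L%:R by rewrite mulr_ge0.
    exists (Num.truncn (x * L%:R)).
      rewrite -(ltr_nat R); apply: le_lt_trans (_ : x * L%:R < _).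
        by have /andP[] := truncn_itv xL0.
      by rewrite gtr_pMl ?ltr0n // lt_neqAle xn1.
    have /andP[h1 h2] := truncn_itv xL0.
    have hle := ler_wpM2r (ltW h0); have xE : x = x * L%:R * h by rewrite -mulrA Lh mulr1.
    rewrite /I /= in_itv /=; apply/andP; split.
      by rewrite [leRHS]xE; exact: hle h1.
    by rewrite [leLHS]xE; exact: hle (ltW h2).
  rewrite -bigcup_seq; exists n => //=.
  by rewrite mem_filter mem_iota /= nL andbT; apply/asboolP; exists x.
(* Otherwise [E] would be covered by intervals of total length at most [2 (d + 1) h = 1/2]. *)
have szt : (2 * d.+1 < size t)%N.
  rewrite ltnNge; apply/negP => szt.
  have mI n : measurable (I n) by exact: measurable_itv.
  have mB (u : seq nat) : measurable (\big[setU/set0]_(n <- u) I n).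
    by apply: bigsetU_measurable => n _; exact: mI.
  suff : (lebesgue_measure E <= (2^-1)%:E)%E by rewrite leNgt muE.
  apply: (@le_trans _ _ (lebesgue_measure (\big[setU/set0]_(n <- t) I n))).
    by apply: le_measure; rewrite ?inE; [exact: mE | exact: mB | exact: covE].
  apply: (@le_trans _ _ ((size t)%:R * h)%:E); last first.
    rewrite lee_fin -[2^-1](_ : (2 * d.+1)%:R * h = _); last first.
      by rewrite /h LE !natrM; field; rewrite ?nat1r ?pnatr_eq0.
    by rewrite ler_wpM2r ?(ltW h0) // ler_nat.
  elim: (t) => [|n u IH]; first by rewrite big_nil measure0 mul0r.
  rewrite big_cons.
  apply: (@le_trans _ _ (lebesgue_measure (I n) +
                          lebesgue_measure (\big[setU/set0]_(j <- u) I j))%E).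
    by apply: measureU2; [exact: mI | exact: mB].
  rewrite /= -natr1 mulrDl mul1r addrC EFinD leeD //.
  rewrite lebesgue_measure_itv /= lte_fin ltr_pM2r // ltr_nat leqnn lee_fin.
  by rewrite -mulrBl -natr1 addrAC subrr add0r mul1r.
have st : sorted ltn t by rewrite sorted_filter ?iota_ltn_sorted //; exact: ltn_trans.
have /boolp.choice [s0 hs0] : forall i, exists x, (i <= d)%N -> E x /\ I (nth 0%N t (2 * i)) x.
  move=> i; case: (leqP i d) => id; last by exists 0.
  have : nth 0%N t (2 * i) \in t by apply: mem_nth; apply: leq_trans szt; move: id; clear; lia.
  by rewrite mem_filter => /andP[/asboolP[x [Ex Ix]] _]; exists x.
(* Past [d] the sequence continues beyond 1 with step [h], so that the gap bound holds on all of
   [nat] and makes the nodes injective. *)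
exists (fun i => if (i <= d)%N then s0 i else 1 + i%:R * h); split; last first.
  by move=> i id; rewrite id; have [] := hs0 i id.
move=> i j ij; have [jd|dj] := leqP j d.
  rewrite (leq_trans ij jd).
  have [_] := hs0 _ (leq_trans ij jd); rewrite /I /= in_itv /= => /andP[_ hi].
  have [_] := hs0 _ jd; rewrite /I /= in_itv /= => /andP[hj _].
  move: ij; rewrite leq_eqVlt => /predU1P[->|ij]; first by rewrite subnn mul0r subrr.
  (* The two interval numbers are at least [2 (j - i)] apart; giving up one interval length still
     leaves [j - i] of them. *)
  have gap := @sorted_ltn_nth_gap t (2 * i) (2 * j) st _ _.
  apply: le_trans (lerB hj hi); rewrite -mulrBl ler_wpM2r ?(ltW h0) //.
  by rewrite -natrB ?ler_nat; lia.
have [id|di] := leqP i d; last first.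
  by rewrite opprD addrACA subrr add0r -mulrBl -natrB.
have [/E01 /=] := hs0 _ id; rewrite in_itv /= => /andP[_ si1] _.
have : (j - i)%:R * h <= j%:R * h by rewrite ler_wpM2r ?(ltW h0) // ler_nat leq_subr.
lra.
Qed.

(** The bound is uniform over the family; the induction on variables takes for [A] all pairs of a
    degree and a multi-index. *)
Lemma coef_decay (R : realType) (A : Type) (deg : A -> nat) (p : A -> {poly R}) :
  (forall a, size (p a) <= (deg a).+1)%N ->
  (forall s T : R, 0 <= T -> exists M, forall a, `|(p a).[s]| * T ^+ deg a <= M) ->
  forall T, 0 <= T -> exists M, forall a i, `|(p a)`_i| * T ^+ deg a <= M.
Proof.
(* The rate [128 * T] in [F] pays in advance for the factor [128 ^ d] lost by interpolation; only
   the factor 2 remains. *)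
move=> szp hp T T0.
pose F n : set R := `[0, 1]%classic `&`
  \bigcap_a [set s | `|(p a).[s]| * (128 * T) ^+ deg a <= n%:R].
have clF n : closed (F n).
  apply: closedI; first exact: interval_closed.
  apply: closed_bigI => a _.
  pose q s := `|(p a).[s]| * (128 * T) ^+ deg a.
  apply: (@preimage_closed _ _ q [set x | x <= n%:R]); last exact: closed_le.
  by move=> s _; apply: cvgM; [apply: cvg_norm; exact: continuous_horner | exact: cvg_cst].
have mF n : measurable (F n) by exact: measurable_realfun.closed_measurable.
have UF : \bigcup_n F n = `[0, 1]%classic.
  apply/seteqP; split=> [s [n _ []] //|s s01].
  have [M hM] := hp s (128 * T) (mulr_ge0 (ler0n _ _) T0).
  exists (Num.truncn `|M|).+1 => //; split => // a _ /=.
  apply: (le_trans (hM a)); apply: (le_trans (ler_norm _)); apply: ltW.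
  by have /andP[] := truncn_itv (normr_ge0 M).
have [n hn] : exists n, ((2^-1)%:E < lebesgue_measure (F n))%E.
  have : lebesgue_measure \o F @ \oo --> lebesgue_measure (\bigcup_n F n).
    apply: nondecreasing_cvg_mu => //; first by rewrite UF.
    move=> n k nk; apply/subsetPset => s [s01 hs]; split => // a aT.
    by apply: le_trans (hs a aT) _; rewrite ler_nat.
  rewrite UF lebesgue_measure_itv /= lte_fin ltr01 oppr0 adde0 => hl.
  have : \forall k \near \oo, ((2^-1)%:E < (lebesgue_measure \o F) k)%E.
    apply: (hl [set x | ((2^-1)%:E < x)%E]).
    apply: open_nbhs_nbhs; split; first exact: open_ereal_gt_ereal.
    by rewrite /= lte_fin; lra.
  by move=> [k _ /(_ k (leqnn k))]; exists k.
exists (n%:R * 2) => a i.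
have [s [sgap sF]] := spaced_points (deg a) (mF n) (@subIsetl _ _ _) hn.
have := @coef_bound_of_spaced_nodes R (deg a) ((128 * T) ^+ deg a *: p a) s n%:R _ sgap _ i.
rewrite coefZ normrM ger0_norm ?exprn_ge0 ?mulr_ge0 // exprMn => H.
rewrite -(ler_pM2r (_ : 0 < 128 ^+ deg a)) ?exprn_gt0 //.
rewrite -[_ * 2 * _]mulrA; apply: le_trans (H _ _).
- by rewrite mulrC [_ * T ^+ _]mulrC mulrA.
- exact: leq_trans (size_scale_leq _ _) (szp a).
- move=> k /sF [/= sk hk]; split; first by move: sk; rewrite in_itv.
  rewrite hornerZ normrM ger0_norm; last by rewrite mulr_ge0 ?exprn_ge0.
  by rewrite mulrC -exprMn; exact: (hk a Logic.I).
Qed.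

(** * Decay of coefficients in several variables *)

Section PowerSeries.
Variables (R : realType) (m : nat) (a : ('I_m -> nat) -> R).

Definition homogeneous_part (k : nat) (x : 'rV[R]_m) : R :=
  \sum_(j : {ffun 'I_m -> 'I_k.+1} | (\sum_l j l)%N == k)
    a (fun l => j l : nat) * \prod_(l < m) x 0 l ^+ j l.

Lemma homogeneous_partZ k c x : homogeneous_part k (c *: x) = c ^+ k * homogeneous_part k x.
Proof.
rewrite /homogeneous_part mulr_sumr; apply: eq_bigr => j /eqP jk.
rewrite mulrCA; congr (_ * _).
rewrite -[in c ^+ k]jk expr_sum -big_split /=.
by apply: eq_bigr => l _; rewrite mxE exprMn.
Qed.

Hypothesis cvga : forall x, cvgn (series (fun k => homogeneous_part k x)).

(** By homogeneity [T ^ k] is absorbed by evaluating at [T *: x], where the terms of a convergent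
    series are bounded. *)
Lemma homogeneous_part_decay (x : 'rV[R]_m) (T : R) : 0 <= T ->
  exists M, forall k, `|homogeneous_part k x| * T ^+ k <= M.
Proof.
move=> T0; have /cvg_series_cvg_0 /cvgP /cvg_seq_bounded [M [_ hM]] := @cvga (T *: x).
exists (M + 1) => k; have := hM (M + 1) (ltr_pwDr ltr01 (lexx _)) k Logic.I.
by rewrite /= homogeneous_partZ normrM ger0_norm ?exprn_ge0 // mulrC.
Qed.

(* The part of [homogeneous_part k] in which the first [r] exponents agree with
   those of [jf], with the powers of the first [r] variables removed. *)
Definition partial_coef (r k : nat) (jf : {ffun 'I_m -> 'I_k.+1}) (x : 'I_m -> R) : R :=
  \sum_(j : {ffun 'I_m -> 'I_k.+1} | ((\sum_l j l)%N == k) &&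
        [forall l : 'I_m, (l < r)%N ==> (j l == jf l)])
    a (fun l => j l : nat) * \prod_(l < m | (r <= l)%N) x l ^+ j l.

Definition set_index k (jf : {ffun 'I_m -> 'I_k.+1}) (r : 'I_m) (i : 'I_k.+1) :
    {ffun 'I_m -> 'I_k.+1} :=
  [ffun l => if l == r then i else jf l].

(** Grouping multi-indices by their [r]-th exponent gives a polynomial in the [r]-th variable whose
    coefficients belong to the next level, ready for [coef_decay]. *)
Lemma partial_coef_horner (r : 'I_m) k (jf : {ffun 'I_m -> 'I_k.+1}) (x : 'I_m -> R) (s : R) :
  (\poly_(i < k.+1) partial_coef r.+1 (set_index jf r (inord i)) x).[s] =
  partial_coef r jf (fun l => if l == r then s else x l).
Proof.
have neq (l : 'I_m) : (l < r)%N -> (l == r) = false by rewrite -val_eqE /= => /ltn_eqF.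
rewrite horner_poly [RHS](partition_big (fun j : {ffun 'I_m -> 'I_k.+1} => j r) xpredT) //=.
apply: eq_bigr => i _; rewrite inord_val /partial_coef mulr_suml.
apply: eq_big => [j|j /andP[_ /forallP /(_ r)]].
  rewrite -andbA; congr (_ && _).
  apply/forallP/andP => [h|[/forallP h /eqP jr] l].
    split; last by have := h r; rewrite ltnSn ffunE eqxx.
    apply/forallP => l; apply/implyP => lr; have := h l.
    by rewrite ltnS (ltnW lr) ffunE neq.
  apply/implyP; rewrite ltnS leq_eqVlt ffunE => /orP[/eqP/val_inj ->|lr]; first by rewrite eqxx jr.
  by rewrite neq //; exact: (implyP (h l)).
rewrite ltnSn ffunE eqxx /= => /eqP jr.
rewrite -mulrA; congr (_ * _); rewrite [RHS](bigD1 r) //= eqxx jr mulrC; congr (_ * _).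
apply: eq_big => [l|l rl]; first by rewrite ltn_neqAle andbC eq_sym.
by rewrite -val_eqE /= gtn_eqF.
Qed.

(** Induction on the number of variables already traded for exponents, starting from the homogeneous
    part. The hypothesis ranges over all [x] and [T] because [coef_decay] needs every value of the
    next variable and every rate. *)
Lemma partial_coef_decay (r : nat) : (r <= m)%N -> forall (x : 'I_m -> R) (T : R), 0 <= T ->
  exists M, forall k (jf : {ffun 'I_m -> 'I_k.+1}), `|partial_coef r jf x| * T ^+ k <= M.
Proof.
elim: r => [_|r IH rm] x T T0.
  have [M hM] := homogeneous_part_decay (\row_l x l) T0.
  exists M => k jf; rewrite (_ : partial_coef _ _ _ = homogeneous_part k (\row_l x l)) //.
  rewrite /partial_coef /homogeneous_part; apply: eq_big => [j|j _].
    by rewrite andb_idr // => _; apply/forallP.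
  by congr (_ * _); apply: eq_bigr => l _; rewrite mxE.
pose ro := Ordinal rm.
pose p (A : {k : nat & {ffun 'I_m -> 'I_k.+1}}) : {poly R} :=
  \poly_(i < (tag A).+1) partial_coef r.+1 (set_index (tagged A) ro (inord i)) x.
have [M hM] : exists M, forall A i, `|(p A)`_i| * T ^+ tag A <= M.
  apply: coef_decay => // [A|s T' T'0]; first exact: size_poly.
  have [M hM] := IH (ltnW rm) (fun l => if l == ro then s else x l) T' T'0.
  by exists M => A; rewrite /p (partial_coef_horner ro); exact: hM.
exists M => k jf; have := hM (Tagged (fun k => {ffun 'I_m -> 'I_k.+1}) jf) (jf ro).
rewrite coef_poly ltn_ord inord_val /= (_ : set_index jf ro (jf ro) = jf) //.
by apply/ffunP => l; rewrite ffunE; case: eqP => // ->.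
Qed.

(** At level [m] all exponents are fixed, so [partial_coef] is a single coefficient. *)
Lemma power_series_coef_decay (T : R) : 0 <= T ->
  exists M, forall k (j : {ffun 'I_m -> 'I_k.+1}), (\sum_l j l)%N = k ->
    `|a (fun l => j l : nat)| * T ^+ k <= M.
Proof.
move=> T0; have [M hM] := partial_coef_decay (leqnn m) (fun=> 0) T0.
exists M => k j jk; rewrite (_ : a _ = partial_coef m j (fun=> 0)) //.
rewrite /partial_coef (big_pred1 j) => [|j'].
  by rewrite big_pred0 ?mulr1 // => l; rewrite leqNgt ltn_ord.
apply/andP/eqP => [[_ /forallP h]|->]; last first.
  by rewrite jk eqxx; split => //; apply/forallP => l; rewrite eqxx implybT.
by apply/ffunP => l; have := h l; rewrite ltn_ord => /eqP.
Qed.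

(** There are at most [(k + 1) ^ m <= (2 ^ m) ^ k] multi-indices of degree [k]. Coefficient decay at
    rate [2 ^ m * 2 * D] absorbs this count and [D ^ k], and leaves a factor 1/2 per degree. *)
Lemma power_series_summable (D : R) : 0 <= D ->
  exists2 M, 0 <= M & forall k,
    \sum_(j : {ffun 'I_m -> 'I_k.+1} | (\sum_l j l)%N == k) `|a (fun l => j l : nat)| * D ^+ k
      <= M * 2^-1 ^+ k.
Proof.
move=> D0; have T0 : 0 <= 2 ^+ m * 2 * D by rewrite !mulr_ge0 ?exprn_ge0.
have [M hM] := power_series_coef_decay T0.
exists `|M| => // k.
rewrite exprVn ler_pdivlMr ?exprn_gt0 // mulr_suml.
rewrite -(ler_pM2r (_ : 0 < (2 ^+ m) ^+ k)) ?exprn_gt0 // mulr_suml.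
apply: (@le_trans _ _ (\sum_(j : {ffun 'I_m -> 'I_k.+1} | (\sum_l j l)%N == k) `|M|)).
  apply: ler_sum => j /eqP jk; apply: le_trans (ler_norm M); apply: le_trans (hM k j jk).
  by rewrite !exprMn -!mulrA ler_wpM2l // mulrC mulrA mulrC -mulrA mulrCA mulrC -mulrA.
apply: (@le_trans _ _ (\sum_(j : {ffun 'I_m -> 'I_k.+1}) `|M|)).
  rewrite [leRHS](bigID (fun j : {ffun 'I_m -> 'I_k.+1} => (\sum_l j l)%N == k)) /= lerDl.
  exact: sumr_ge0.
rewrite sumr_const card_ffun !card_ord -[_ *+ (_ ^ _)]mulr_natr ler_wpM2l //.
rewrite -exprM mulnC exprM -!natrX ler_nat; case: (posnP m) => [->|m0]; first by rewrite !expn0.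
by rewrite leq_exp2r // ltn_expl.
Qed.

End PowerSeries.

(** * Differentiability from a quadratic remainder *)

Lemma differentiable_sum_fun (R : numFieldType) (V W : normedModType R) (I : Type) (r : seq I)
    (P : pred I) (F : I -> V -> W) (x : V) :
  (forall i, differentiable (F i) x) -> differentiable (fun y => \sum_(i <- r | P i) F i y) x.
Proof.
move=> dF; rewrite (_ : (fun _ => _) = \sum_(i <- r | P i) F i); last first.
  by apply/funext => y; rewrite fct_sumE.
elim/big_ind : _ => [|f g|i _]; [exact: differentiable_cst | exact: differentiableD | exact: dF].
Qed.

Section LinearForm.
Variables (R : realType) (m : nat).

Definition row_form (g h : 'rV[R]_m) : R := \sum_l h 0 l * g 0 l.

Fact row_form_is_linear g : linear (row_form g : 'rV[R]_m -> R).
Proof.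
move=> c u v; rewrite /row_form scaler_sumr -big_split /=.
by apply: eq_bigr => l _; rewrite !mxE mulrDl -mulrA.
Qed.

HB.instance Definition _ g :=
  GRing.isLinear.Build R 'rV[R]_m R _ (row_form g) (row_form_is_linear g).

Lemma row_form_continuous g : continuous (row_form g).
Proof.
move=> h; apply: differentiable_continuous; apply: differentiable_sum_fun => l.
apply: differentiableM; [exact: differentiable_coord | exact: differentiable_cst].
Qed.

Lemma differentiable_of_quadratic_remainder (f : 'rV[R]_m -> R) (x g : 'rV[R]_m) (C : R) :
  (forall h, `|h| <= 1 -> `|f (x + h) - f x - row_form g h| <= C * `|h| ^+ 2) ->
  differentiable f x.
Proof.
move=> hf.
have cg : continuous (row_form g) by exact: row_form_continuous.
have eq_f : f \o shift x = (cst (f x) + row_form g : 'rV[R]_m -> R) +o_ (0 : 'rV[R]_m) id.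
  apply/eqaddoP => e e0; near=> h.
  have h1 : `|h| <= 1 by near: h; exact: (@nbhs0_le R 'rV[R]_m 1 ltr01).
  (* This makes the quadratic remainder at most [e] times the norm of [h]; adding 1 keeps the
     denominator positive. *)
  have he : `|h| <= e / (1 + `|C|).
    by near: h; apply: (@nbhs0_le R 'rV[R]_m); rewrite divr_gt0 // ltr_pwDl.
  rewrite /= !fctE /= /cst /shift /= [h + x]addrC opprD addrA.
  apply: (le_trans (hf h h1)); rewrite expr2 mulrA ler_wpM2r //.
  move: he; rewrite ler_pdivlMr ?ltr_pwDl // mulrDr mulr1 mulrC => he.
  have := ler_wpM2r (normr_ge0 h) (ler_norm C); have := normr_ge0 h; lra.
have dfE : 'd f x = row_form g :> ('rV[R]_m -> R) by exact: diff_unique.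
by apply/diff_locallyP; rewrite dfE.
Unshelve. all: by end_near.
Qed.
End LinearForm.

(** * Differentiability of an everywhere convergent power series *)

Lemma coord_le_mx_norm (R : realType) (m n : nat) (M : 'M[R]_(m, n)) i j : `|M i j| <= `|M|.
Proof.
rewrite [leRHS]/Num.norm /= mx_normrE.
exact: (le_bigmax _ (fun ij : 'I_m * 'I_n => `|M ij.1 ij.2|) (i, j)).
Qed.

Section Taylor.
Variables (R : realType) (m : nat) (x0 : 'rV[R]_m).

(* [B] bounds all coordinates on the unit ball around [x0]. *)
Let B : R := 1 + `|x0|.

(** A quantitative first-order expansion at [x0], meant for monomials [F] of degree [n] with
    gradient [g]. All constants are geometric in [n], so they can be summed against the coefficients
    of the series. *)
Definition first_order_bound (n : nat) (F : 'rV[R]_m -> R) (g : 'rV[R]_m) : Prop :=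
  [/\ `|F x0| <= B ^+ n,
      forall l, `|g 0 l| <= (2 * B) ^+ n,
      forall h, `|row_form g h| <= (2 * B) ^+ n * `|h|
    & forall h, `|h| <= 1 ->
        `|F (x0 + h) - F x0 - row_form g h| <= (2 * B) ^+ n * `|h| ^+ 2].

Lemma row_form_sum (I : Type) (r : seq I) (P : pred I) (c : I -> R) (g : I -> 'rV[R]_m) h :
  row_form (\sum_(i <- r | P i) c i *: g i) h = \sum_(i <- r | P i) c i * row_form (g i) h.
Proof.
rewrite /row_form; under eq_bigr do rewrite summxE mulr_sumr.
rewrite exchange_big /=; apply: eq_bigr => i _; rewrite mulr_sumr.
by apply: eq_bigr => l _; rewrite mxE mulrCA.
Qed.

Lemma row_form_delta (l : 'I_m) (h : 'rV[R]_m) : row_form (delta_mx 0 l) h = h 0 l :> R.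
Proof.
rewrite /row_form (bigD1 l) //= mxE !eqxx mulr1 big1 ?addr0 // => i il.
by rewrite mxE (negbTE il) andbF mulr0.
Qed.

Lemma row_formDZ c d (g g' h : 'rV[R]_m) :
  row_form (c *: g + d *: g') h = c * row_form g h + d * row_form g' h.
Proof.
rewrite /row_form !mulr_sumr -big_split /=; apply: eq_bigr => l _.
by rewrite !mxE mulrDr !(mulrCA (h 0 l)).
Qed.

Lemma first_order_bound1 : first_order_bound 0 (fun=> 1) 0.
Proof.
have r0 h : row_form (0 : 'rV[R]_m) h = 0 by rewrite /row_form big1 // => l _; rewrite mxE mulr0.
split=> [|l|h|h _]; rewrite ?r0 ?expr0 ?mxE ?normr0 ?normr1 ?mul1r //.
by rewrite subrr subr0 normr0 exprn_ge0.
Qed.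

(** This is the Leibniz rule. The gradient and remainder constants become
    [(2 * B) ^ n + B * (2 * B) ^ n], at most [(2 * B) ^ n.+1] since [B >= 1]. *)
Lemma first_order_bound_coord n F g (l : 'I_m) : first_order_bound n F g ->
  exists g', first_order_bound n.+1 (fun x => x 0 l * F x) g'.
Proof.
move=> [hF hg hL hr]; exists (F x0 *: delta_mx 0 l + x0 0 l *: g).
have B1 : 1 <= B by rewrite lerDl.
have xB : `|x0 0 l| <= B by apply: le_trans (coord_le_mx_norm _ _ _) _; rewrite lerDr.
have BK : B ^+ n <= (2 * B) ^+ n by rewrite lerXn2r ?nnegrE; lra.
have K0 : 0 <= (2 * B) ^+ n by rewrite exprn_ge0 //; lra.
have hl h : `|(h : 'rV[R]_m) 0 l| <= `|h| by exact: coord_le_mx_norm.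
have B0 : 0 <= B ^+ n by rewrite exprn_ge0 //; lra.
have KB : (2 * B) ^+ n + B * (2 * B) ^+ n <= (2 * B) ^+ n.+1 by rewrite exprS; nra.
split=> [|l'|h|h h1].
- by rewrite normrM exprS ler_pM.
- apply: le_trans KB; rewrite !mxE; apply: (le_trans (ler_normD _ _)); rewrite !normrM.
  apply: lerD; last exact: ler_pM.
  apply: le_trans BK; apply: le_trans hF; rewrite ler_piMr //.
  by case: (_ && _); rewrite ?normr1 ?normr0.
- rewrite row_formDZ row_form_delta; apply: le_trans (ler_wpM2r (normr_ge0 h) KB).
  apply: (le_trans (ler_normD _ _)); rewrite !normrM mulrDl -mulrA lerD //; last by rewrite ler_pM.
  by rewrite ler_pM // (le_trans hF).
- rewrite row_formDZ row_form_delta mxE.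
  (* The new error is a coordinate of [x0 + h], at most [B] in size, times the old error, plus a
     product of two terms of first order in [h]. *)
  have -> : (x0 0 l + h 0 l) * F (x0 + h) - x0 0 l * F x0 - (F x0 * h 0 l + x0 0 l * row_form g h) =
    (x0 0 l + h 0 l) * (F (x0 + h) - F x0 - row_form g h) + h 0 l * row_form g h by ring.
  have xhB : `|x0 0 l + h 0 l| <= B.
    apply: (le_trans (ler_normD _ _)); rewrite /B addrC lerD // ?coord_le_mx_norm //.
    exact: le_trans (hl h) h1.
  apply: le_trans (ler_wpM2r (exprn_ge0 2 (normr_ge0 h)) KB).
  apply: (le_trans (ler_normD _ _)); rewrite !normrM addrC mulrDl -mulrA lerD //.
    by rewrite expr2 mulrCA ler_pM.
  by rewrite ler_pM // hr.
Qed.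

Lemma first_order_bound_ext n F F' g :
  F =1 F' -> first_order_bound n F g -> first_order_bound n F' g.
Proof. by move=> /funext ->. Qed.

(** The monomial is built one coordinate factor at a time, by induction on the list of variables and
    then on each exponent. *)
Lemma first_order_bound_monomial (j : 'I_m -> nat) :
  exists g, first_order_bound (\sum_l j l)%N (fun x => \prod_(l < m) x 0 l ^+ j l) g.
Proof.
elim: (index_enum _) => [|l s [g IH]].
  exists 0; rewrite big_nil.
  by apply: first_order_bound_ext first_order_bound1 => x; rewrite big_nil.
rewrite big_cons.
have -> : (fun x : 'rV[R]_m => \prod_(i <- l :: s) x 0 i ^+ j i) =
    fun x => x 0 l ^+ j l * \prod_(i <- s) x 0 i ^+ j i.
  by apply/funext => x; rewrite big_cons.
elim: (j l) => [|n [g' IHn]].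
  by exists g; apply: first_order_bound_ext IH => x; rewrite expr0 mul1r.
have [g'' hg''] := first_order_bound_coord l IHn.
by exists g''; apply: first_order_bound_ext hg'' => x; rewrite exprS mulrA.
Qed.

End Taylor.

Section EntireSeries.
Variables (R : realType) (m : nat) (a : ('I_m -> nat) -> R) (f : 'rV[R]_m -> R).
Hypothesis fE : forall x, series (fun k => homogeneous_part a k x) @ \oo --> f x.

Let cvga x : cvgn (series (fun k => homogeneous_part a k x)).
Proof. by apply/cvg_ex; exists (f x); exact: fE. Qed.

(** Termwise differentiation: the expansions in degree [k] have constants [K ^ k], and
    [power_series_summable] at [D = K] makes their weighted sums geometric in [k]. Hence both the
    gradients and the quadratic errors can be summed. *)
Lemma entire_series_differentiable (x0 : 'rV[R]_m) : differentiable f x0.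
Proof.
set K := 2 * (1 + `|x0|).
have K0 : 0 <= K by rewrite mulr_ge0 // addr_ge0.
have [M M0 hM] := power_series_summable cvga K0.
have /boolp.choice [g hg] : forall j : 'I_m -> nat, exists g : 'rV[R]_m,
    first_order_bound x0 (\sum_l j l)%N (fun x => \prod_(l < m) x 0 l ^+ j l) g.
  exact: first_order_bound_monomial.
pose G k := \sum_(j : {ffun 'I_m -> 'I_k.+1} | (\sum_l j l)%N == k)
  a (fun l => j l : nat) *: g (fun l => j l : nat).
have hG k l : `|G k 0 l| <= M * 2^-1 ^+ k.
  apply: le_trans (hM k); rewrite summxE; apply: (le_trans (ler_norm_sum _ _ _)).
  apply: ler_sum => j /eqP jk; rewrite mxE normrM ler_wpM2l //.
  by have [_ + _ _] := hg (fun l => j l : nat); rewrite jk; exact.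
have hr k h : `|h| <= 1 ->
    `|homogeneous_part a k (x0 + h) - homogeneous_part a k x0 - row_form (G k) h|
      <= M * 2^-1 ^+ k * `|h| ^+ 2.
  move=> h1; apply: le_trans (ler_wpM2r (exprn_ge0 2 (normr_ge0 h)) (hM k)).
  rewrite row_form_sum -!sumrB; apply: (le_trans (ler_norm_sum _ _ _)); rewrite mulr_suml.
  apply: ler_sum => j /eqP jk; rewrite -!mulrBr normrM -mulrA ler_wpM2l //.
  by have [_ _ _ /(_ h h1)] := hg (fun l => j l : nat); rewrite jk; exact.
have cgeo : cvgn (series (geometric M (2^-1 : R))).
  by apply: is_cvg_geometric_series; rewrite ger0_norm //; lra.
have cG l : cvgn (series (fun k => G k 0 l)).
  apply: normed_cvg; apply: (series_le_cvg _ _ _ cgeo) => k //; last exact: hG.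
    exact: normr_ge0.
  by rewrite /geometric /= mulr_ge0 // exprn_ge0.
pose g0 : 'rV[R]_m := \row_l limn (series (fun k => G k 0 l)).
apply: (@differentiable_of_quadratic_remainder _ _ _ _ g0
  (limn (series (geometric M (2^-1 : R))))) => h h1.
(* The remainder bound is proved for partial sums and passed to the limit. *)
have cvg_rem : (series (fun k => homogeneous_part a k (x0 + h)) n
     - series (fun k => homogeneous_part a k x0) n
     - row_form (\row_l series (fun k => G k 0 l) n) h) @[n --> \oo]
    --> f (x0 + h) - f x0 - row_form g0 h.
  apply: cvgB; first by apply: cvgB; exact: fE.
  rewrite /row_form; apply: cvg_big => [|l _]; first exact: add_continuous.
  rewrite mxE; under eq_fun do rewrite mxE; by apply: cvgM; [exact: cvg_cst | exact: cG].
have cvg_geo : series (geometric M (2^-1 : R)) n * `|h| ^+ 2 @[n --> \oo] -->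
    limn (series (geometric M (2^-1 : R))) * `|h| ^+ 2.
  by apply: cvgM; [exact: cgeo | exact: cvg_cst].
apply: (ler_cvg_to (cvg_norm cvg_rem) cvg_geo); apply: nearW => n.
have -> : row_form (\row_l series (fun k => G k 0 l) n) h = \sum_(0 <= k < n) row_form (G k) h.
  rewrite /row_form exchange_big /=; apply: eq_bigr => l _.
  by rewrite mxE /series /= mulr_sumr.
rewrite /series /= -!sumrB mulr_suml.
apply: (le_trans (ler_norm_sum _ _ _)); apply: ler_sum => k _; exact: hr.
Qed.

End EntireSeries.

(** * The non-commutative series *)

Section RowSums.
Variables (R : realType) (N : nat).

(** A bound on the operator norm for the sup norm of vectors. Unlike the largest-entry norm it is
    submultiplicative with no factor [N]. *)
Definition row_sum_le (c : R) (A : 'M[R]_N) : Prop := forall p, \sum_q `|A p q| <= c.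

Lemma row_sum_le1 : row_sum_le 1 1.
Proof.
move=> p; rewrite (bigD1 p) //= mxE eqxx normr1 big1 ?addr0 // => q qp.
by rewrite mxE eq_sym (negbTE qp) normr0.
Qed.

Lemma row_sum_leM c d A B : row_sum_le c A -> row_sum_le d B -> row_sum_le (c * d) (A * B).
Proof.
move=> hA hB p; have d0 : 0 <= d by apply: le_trans (hB p); exact: sumr_ge0.
apply: (@le_trans _ _ (\sum_r `|A p r| * \sum_q `|B r q|)).
  under [leRHS]eq_bigr do rewrite mulr_sumr; rewrite exchange_big /=.
  apply: ler_sum => q _; rewrite mxE; apply: (le_trans (ler_norm_sum _ _ _)).
  by apply: ler_sum => r _; rewrite normrM.
apply: le_trans (ler_wpM2r d0 (hA p)); rewrite mulr_suml.
by apply: ler_sum => r _; rewrite ler_wpM2l.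
Qed.

Lemma row_sum_leX c A n : row_sum_le c A -> row_sum_le (c ^+ n) (A ^+ n).
Proof.
move=> hA; elim: n => [|n IH]; first by rewrite !expr0; exact: row_sum_le1.
by rewrite !exprS; exact: row_sum_leM.
Qed.

Lemma row_sum_le_prod (I : Type) (r : seq I) (c : I -> R) (A : I -> 'M[R]_N) :
  (forall i, row_sum_le (c i) (A i)) -> row_sum_le (\prod_(i <- r) c i) (\prod_(i <- r) A i).
Proof.
move=> hA; elim: r => [|i r IH]; first by rewrite !big_nil; exact: row_sum_le1.
by rewrite !big_cons; exact: row_sum_leM.
Qed.

Lemma row_sum_le_sum (I : Type) (r : seq I) (P : pred I) (b c : I -> R) (A : I -> 'M[R]_N) :
  (forall i, P i -> row_sum_le (c i) (A i)) ->
  row_sum_le (\sum_(i <- r | P i) `|b i| * c i) (\sum_(i <- r | P i) b i *: A i).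
Proof.
move=> hA p.
apply: (@le_trans _ _ (\sum_(i <- r | P i) \sum_q `|b i| * `|A i p q|)).
  rewrite exchange_big /=; apply: ler_sum => q _; rewrite summxE.
  by apply: (le_trans (ler_norm_sum _ _ _)); apply: ler_sum => i _; rewrite mxE normrM.
by apply: ler_sum => i Pi; rewrite -mulr_sumr ler_wpM2l //; exact: hA.
Qed.

Lemma eigen_expr (A : 'M[R]_N) (v : 'cV[R]_N) c n :
  A *m v = c *: v -> A ^+ n *m v = c ^+ n *: v.
Proof.
move=> Av; elim: n => [|n IH]; first by rewrite !expr0 mul1mx scale1r.
by rewrite exprSr -mulmxA Av -scalemxAr IH scalerA exprS.
Qed.

(** On a common eigenvector the factors act as scalars, so their order is forgotten even when the
    matrices do not commute. *)
Lemma eigen_prod (I : Type) (r : seq I) (A : I -> 'M[R]_N) (v : 'cV[R]_N) (c : I -> R) :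
  (forall i, A i *m v = c i *: v) -> (\prod_(i <- r) A i) *m v = (\prod_(i <- r) c i) *: v.
Proof.
move=> Av; elim: r => [|i r IH]; first by rewrite !big_nil mul1mx scale1r.
by rewrite !big_cons -mulmxA IH -scalemxAr Av scalerA mulrC.
Qed.

Lemma mx_cvg (F : nat -> 'M[R]_N) (L : 'M[R]_N) :
  (forall p q, F n p q @[n --> \oo] --> L p q) -> F @ \oo --> L.
Proof.
move=> FL; rewrite [L]matrix_sum_delta.
rewrite (_ : F = fun n => \sum_p \sum_q F n p q *: delta_mx p q); last first.
  by apply/funext => n; exact: matrix_sum_delta.
apply: cvg_big => [|p _]; first exact: add_continuous.
apply: cvg_big => [|q _]; first exact: add_continuous.
by apply: cvgZ; [exact: FL | exact: cvg_cst].
Qed.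

Lemma mulmx_entry_cvg (n1 n2 : nat) (A : 'M[R]_(n1, N)) (B : 'M[R]_(N, n2))
    (F : nat -> 'M[R]_N) (L : 'M[R]_N) p q :
  (forall r t, F n r t @[n --> \oo] --> L r t) ->
  (A *m F n *m B) p q @[n --> \oo] --> (A *m L *m B) p q.
Proof.
move=> FL; rewrite (_ : (fun n => (A *m F n *m B) p q) =
    fun n => \sum_t (\sum_r A p r * F n r t) * B t q); last first.
  by apply/funext => n; rewrite mxE; apply: eq_bigr => t _; rewrite mxE.
rewrite mxE; apply: cvg_big => [|t _]; first exact: add_continuous.
apply: cvgM; last exact: cvg_cst.
rewrite mxE; apply: cvg_big => [|r _]; first exact: add_continuous.
by apply: cvgM; [exact: cvg_cst | exact: FL].
Qed.

End RowSums.

Section ExtendedRhs.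
Variables (R : realType) (m N : nat).
Hypothesis N_gt0 : (0 < N)%N.

Definition mean_state (X : 'M[R]_(N, m)) : 'rV[R]_m := \row_l ((\sum_q X q l) / N%:R).

Let N_neq0 : N%:R != 0 :> R. Proof. by rewrite pnatr_eq0 -lt0n. Qed.

Lemma Omega1_ones : Omega1 R N *m const_mx 1 = const_mx 1 :> 'cV[R]_N.
Proof.
apply/matrixP => p q; rewrite !mxE; under eq_bigr do rewrite !mxE mulr1.
by rewrite sumr_const card_ord -[_ *+ N]mulr_natr mulVf.
Qed.

Lemma OmegaXE (X : 'M[R]_(N, m)) l (p q : 'I_N) : OmegaX X l p q = N%:R^-1 * X q l.
Proof. by rewrite /OmegaX mul_mx_diag !mxE. Qed.

Lemma OmegaX_ones (X : 'M[R]_(N, m)) l :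
  OmegaX X l *m const_mx 1 = mean_state X 0 l *: const_mx 1 :> 'cV[R]_N.
Proof.
apply/matrixP => p q; rewrite !mxE mulr1 mulr_suml; apply: eq_bigr => r _.
by rewrite OmegaXE mxE mulr1 mulrC.
Qed.

(** Every permuted product has the same eigenvalue on the all-ones vector, so the ordering enters
    only through the sum of its coefficients, which is 1. *)
Lemma ordered_monomial_ones o (X : 'M[R]_(N, m)) (j : 'I_m -> nat) : is_ordering o ->
  ordered_monomial o X j *m const_mx 1 =
    (\prod_(l < m) mean_state X 0 l ^+ j l) *: const_mx 1 :> 'cV[R]_N.
Proof.
move=> o1; rewrite /ordered_monomial mulmx_suml.
under eq_bigr => s _.
  rewrite -scalemxAl (@eigen_prod _ _ _ _ _ _ (fun l => mean_state X 0 (s l) ^+ j (s l))); last first.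
    by move=> l; apply: eigen_expr; exact: OmegaX_ones.
  rewrite scalerA [X in _ * X](_ : _ = \prod_(l < m) mean_state X 0 l ^+ j l); last first.
    by rewrite [RHS](reindex_inj (@perm_inj _ s)).
  over.
by rewrite -scaler_suml -mulr_suml o1 mul1r.
Qed.

(** A row of [OmegaX] has [N] entries of size at most the norm of [X] divided by [N]. Coefficients
    of an ordering may be negative, hence their absolute values. *)
Lemma ordered_monomial_row_sum o (X : 'M[R]_(N, m)) (j : 'I_m -> nat) :
  row_sum_le ((\sum_s `|o s|) * `|X| ^+ (\sum_l j l)%N) (ordered_monomial o X j).
Proof.
rewrite mulr_suml; apply: row_sum_le_sum => s _.
rewrite (_ : `|X| ^+ _ = \prod_(l < m) `|X| ^+ j (s l)); last first.
  by rewrite -expr_sum; congr (_ ^+ _); rewrite (reindex_inj (@perm_inj _ s)).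
apply: row_sum_le_prod => l; apply: row_sum_leX => p.
apply: (@le_trans _ _ (\sum_(q < N) N%:R^-1 * `|X|)).
  apply: ler_sum => q _; rewrite OmegaXE normrM ger0_norm ?invr_ge0 //.
  by rewrite ler_wpM2l ?invr_ge0 // coord_le_mx_norm.
by rewrite sumr_const card_ord -mulrnAl -[_ *+ N]mulr_natr mulVf // mul1r.
Qed.

Variables (a : ('I_m -> nat) -> R) (f : 'rV[R]_m -> R).
Hypothesis fE : represented_by f a.

(** As [nc_map] is a [lim], its series must first be shown to converge; row sums dominate each entry
    by a geometric series. Then both sides are limits of the same scalar partial sums. *)
Lemma nc_map_ones o (X : 'M[R]_(N, m)) : is_ordering o ->
  Omega1 R N *m nc_map a o X *m const_mx 1 = f (mean_state X) *: const_mx 1 :> 'cV[R]_N.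
Proof.
move=> o1.
have cvga x : cvgn (series (fun k => homogeneous_part a k x)).
  by apply/cvg_ex; exists (f x); exact: fE.
have [M M0 hM] := power_series_summable cvga (normr_ge0 X).
pose T k : 'M[R]_N := \sum_(j : {ffun 'I_m -> 'I_k.+1} | (\sum_l j l)%N == k)
      a (fun l => j l : nat) *: ordered_monomial o X (fun l => j l : nat).
pose C := \sum_s `|o s|; have C0 : 0 <= C by exact: sumr_ge0.
have hT k p q : `|T k p q| <= C * M * 2^-1 ^+ k.
  rewrite -mulrA; apply: le_trans (ler_wpM2l C0 (hM k)).
  apply: (@le_trans _ _ (\sum_q `|T k p q|)).
    by rewrite (bigD1 q) //= lerDl; exact: sumr_ge0.
  have := @row_sum_le_sum R N _ (index_enum _)
    (fun j : {ffun 'I_m -> 'I_k.+1} => (\sum_l j l)%N == k)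
    (fun j => a (fun l => j l : nat)) (fun j => C * `|X| ^+ k)
    (fun j => ordered_monomial o X (fun l => j l : nat)).
  move=> /(_ _ p) hle; apply: le_trans (hle _) _.
    by move=> j /eqP jk; have := ordered_monomial_row_sum o X (fun l => j l : nat); rewrite jk.
  by rewrite mulr_sumr; apply: ler_sum => j _; rewrite mulrCA.
have cT p q : cvgn (series (fun k => T k p q)).
  apply: normed_cvg; apply: (series_le_cvg (v_ := geometric (C * M) 2^-1)) => k.
  - exact: normr_ge0.
  - by rewrite /geometric /= !mulr_ge0 // exprn_ge0.
  - exact: hT.
  - by apply: is_cvg_geometric_series; rewrite ger0_norm //; lra.
pose L : 'M[R]_N := \matrix_(p, q) limn (series (fun k => T k p q)).
have TE n p q : series T n p q = series (fun k => T k p q) n by rewrite /series /= summxE.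
have TL : series T @ \oo --> L.
  by apply: mx_cvg => p q; rewrite mxE; under eq_fun do rewrite TE; exact: cT.
have -> : nc_map a o X = L by exact: cvg_lim TL.
apply/matrixP => p q; rewrite [RHS]mxE [X in _ * X]mxE mulr1.
have sE n : (Omega1 R N *m series T n *m (const_mx 1 : 'cV[R]_N)) p q =
    series (fun k => homogeneous_part a k (mean_state X)) n.
  rewrite /series /= mulmx_sumr mulmx_suml summxE; apply: eq_bigr => k _.
  rewrite /T mulmx_sumr mulmx_suml summxE; apply: eq_bigr => j _.
  rewrite -scalemxAr -scalemxAl -mulmxA ordered_monomial_ones // -scalemxAr Omega1_ones.
  by rewrite !mxE mulr1.
have cL : (Omega1 R N *m series T n *m (const_mx 1 : 'cV[R]_N)) p q @[n --> \oo] -->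
    (Omega1 R N *m L *m (const_mx 1 : 'cV[R]_N)) p q.
  apply: mulmx_entry_cvg => r t.
  by rewrite mxE; under eq_fun do rewrite TE; exact: cT.
have cf : (Omega1 R N *m series T n *m (const_mx 1 : 'cV[R]_N)) p q @[n --> \oo]
    --> f (mean_state X).
  by rewrite (funext sE); exact: fE.
exact: (cvg_unique (@Rhausdorff R) cL cf).
Qed.

End ExtendedRhs.

(** * The Jacobian *)

Section Jacobian.
Variables (R : realType) (m N : nat).

(** The shape [c *: Y + X] is that of the difference quotient in [derive]. *)
Lemma mean_stateDZ (X Y : 'M[R]_(N, m)) (c : R) :
  mean_state (c *: Y + X) = c *: mean_state Y + mean_state X.
Proof.
apply/rowP => l; rewrite !mxE mulrA -mulrDl mulr_sumr -big_split /=.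
by under eq_bigr do rewrite !mxE.
Qed.

Lemma mean_state_delta q (j : 'I_m) :
  mean_state (delta_mx q j : 'M[R]_(N, m)) = N%:R^-1 *: delta_mx 0 j.
Proof.
apply/rowP => l; rewrite !mxE (bigD1 q) //= !mxE eqxx big1 ?addr0 => [|r rq].
  by rewrite mulrC.
by rewrite mxE (negbTE rq).
Qed.

Lemma mean_uniform_state (x : 'rV[R]_m) : (0 < N)%N -> mean_state (uniform_state N x) = x.
Proof.
move=> N0; apply/rowP => l; rewrite mxE; under eq_bigr do rewrite mxE.
by rewrite sumr_const card_ord -[_ *+ N]mulr_natr mulfK // pnatr_eq0 -lt0n.
Qed.

Lemma differentiable_mean_state (X : 'M[R]_(N, m)) : differentiable (@mean_state R m N) X.
Proof.
rewrite (_ : @mean_state R m N = fun X => \sum_l ((\sum_q X q l) / N%:R) *: delta_mx 0 l).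
  apply: differentiable_sum_fun => l; apply: differentiableZl.
  apply: differentiableM; last exact: differentiable_cst.
  by apply: differentiable_sum_fun => q; exact: differentiable_coord.
apply/funext => Y; rewrite [LHS]row_sum_delta.
by apply: eq_bigr => l _; rewrite mxE.
Qed.

Lemma differentiable_mulmx_entry (A : 'M[R]_N) p i (X : 'M[R]_(N, m)) :
  differentiable (fun Y : 'M[R]_(N, m) => (A *m Y) p i : R) X.
Proof.
rewrite (_ : (fun _ => _) = fun Y : 'M[R]_(N, m) => \sum_q A p q * Y q i); last first.
  by apply/funext => Y; rewrite mxE.
apply: differentiable_sum_fun => q; apply: differentiableM;
  [exact: differentiable_cst | exact: differentiable_coord].
Qed.

Lemma derive_mulmx_entry (A : 'M[R]_N) p i (X v : 'M[R]_(N, m)) :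
  'D_v (fun Y : 'M[R]_(N, m) => (A *m Y) p i : R) X = (A *m v) p i.
Proof.
rewrite deriveE; last exact: differentiable_mulmx_entry.
have glin : linear (fun Y : 'M[R]_(N, m) => (A *m Y) p i : R).
  by move=> c u w; rewrite mulmxDr -scalemxAr !mxE.
pose glM := GRing.isLinear.Build _ _ _ _ _ glin.
pose gL : {linear 'M[R]_(N, m) -> R} := HB.pack (fun Y : 'M[R]_(N, m) => (A *m Y) p i : R) glM.
rewrite (@diff_lin _ _ _ gL) // => Y.
exact: (differentiable_continuous (differentiable_mulmx_entry A p i Y)).
Qed.

(** Moving one entry of column [j] by [h] moves the [j]-th mean by [h / N], so the two difference
    quotients coincide; linearity of the differential takes out [1 / N]. *)
Lemma derive_comp_mean_state (f : 'rV[R]_m -> R) (X : 'M[R]_(N, m)) q j :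
  differentiable f (mean_state X) ->
  'D_(delta_mx q j) (f \o @mean_state R m N) X = N%:R^-1 * 'D_(delta_mx 0 j) f (mean_state X).
Proof.
move=> df; transitivity ('D_(N%:R^-1 *: delta_mx 0 j) f (mean_state X)).
  rewrite /derive; apply: (congr1 (fun F : R -> R => lim (F @ (0 : R)^'))).
  by apply/funext => h /=; rewrite mean_stateDZ mean_state_delta.
by rewrite !deriveE // linearZ.
Qed.

End Jacobian.

Theorem proposition3p11 (R : realType) (m N : nat) (hN : (0 < N)%N)
    (f : 'I_m -> 'rV[R]_m -> R)
    (a : 'I_m -> ('I_m -> nat) -> R)
    (hf : forall i : 'I_m, represented_by (f i) (a i))
    (xstar : 'rV[R]_m)
    (hxstar : forall i : 'I_m, f i xstar = 0)
    (o : 'S_m -> R)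
    (ho : is_ordering o)
    (Q : 'I_m -> 'M[R]_N)
    (hQ : forall i : 'I_m, eligible a o (fun l (v : 'cV[R]_N) => Q l *m v) i) :
  let V := extended_rhs a o (fun l (v : 'cV[R]_N) => Q l *m v) in
  differentiable V (uniform_state N xstar) /\
  forall i j : 'I_m,
    jacobian_block V (uniform_state N xstar) i j =
      'D_(delta_mx 0 j) (f i) xstar *: Omega1 R N + (i == j)%:R *: Q i.
Proof.
move=> V.
(* This closed form holds at every state, not only at the equilibrium, so it can be
   differentiated. *)
have VE X p i : V X p i = (f i \o @mean_state R m N) X + (Q i *m X) p i.
  rewrite mxE mxE (nc_map_ones hN (hf i)) // !mxE mulr1; congr (_ + _).
  by apply: eq_bigr => q _; rewrite mxE.
have df i : differentiable (f i) xstar by exact: entire_series_differentiable (hf i) _.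
have mX : mean_state (uniform_state N xstar) = xstar by exact: mean_uniform_state.
have dfm i : differentiable (f i \o @mean_state R m N) (uniform_state N xstar).
  by apply: differentiable_comp; [exact: differentiable_mean_state | rewrite mX].
have dQ p i := differentiable_mulmx_entry (Q i) p i (uniform_state N xstar).
split=> [|i j].
  rewrite (_ : V = fun X => \sum_p \sum_i
    ((f i \o @mean_state R m N) X + (Q i *m X) p i) *: delta_mx p i).
    apply: differentiable_sum_fun => p; apply: differentiable_sum_fun => i.
    by apply: differentiableZl; exact: differentiableD (dfm i) (dQ p i).
  apply/funext => X; rewrite [LHS]matrix_sum_delta.
  by apply: eq_bigr => p _; apply: eq_bigr => i _; rewrite VE.
apply/matrixP => p q; rewrite [LHS]mxE (funext (fun X => VE X p i)).
rewrite (@deriveD _ _ _ _ _ _ _ (diff_derivable (dfm i)) (diff_derivable (dQ p i))).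
(* The factor [1 / N] from the mean is the constant entry of [Omega1]. *)
rewrite derive_comp_mean_state mX // derive_mulmx_entry !mxE mulrC; congr (_ + _).
(* In the product of [Q i] with [delta_mx q j] only the term of index [q] survives, and it is
   nonzero only for [i = j]. *)
rewrite (bigD1 q) //= mxE eqxx eq_sym big1 ?addr0 => [|r rq].
  by rewrite mulrC eq_sym.
by rewrite mxE (negbTE rq) mulr0.
Qed.
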